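(* Let $m,n\in\mathbb N$ with $n\ge 2$, $\mathcal V=\{1,\dots,n\}$, $\mathcal E=\{(i,j)\in\mathcal V\times\mathcal V: i<j\}$, and let $F:\{1,\dots,m\}^n\to\mathbb R$, $F(x)=\sum_{(i,j)\in\mathcal E}f_{i,j}(x_i,x_j)$ with $f_{i,j}:\{1,\dots,m\}^2\to\mathbb R$. The following are equivalent: (1) (marginal null constraint) $\sum_{y\in\{1,\dots,m\}^{n-2}}F\big(z^{k,\ell}(a,b,y)\big)=0$ for all $a,b\in\{1,\dots,m\}$ and all $(k,\ell)\in\mathcal E$. (2) (global null constraint) $F\equiv 0$. (3) (dual null constraint) There exist functions $\rho_{i,j},\rho_{j,i}:\{1,\dots,m\}\to\mathbb R$ for all $(i,j)\in\mathcal E$ and constants $\rho_i\in\mathbb R$ for all $i\in\mathcal V$ such that $f_{i,j}(a,b)=\rho_{i,j}(a)+\rho_{j,i}(b)$ for all $a,b\in\{1,\dots,m\}$ and all $(i,j)\in\mathcal E$; $\sum_{j\in\mathcal V,\,j\ne i}\rho_{i,j}(a)=\rho_i$ for all $a\in\{1,\dots,m\}$ and all $i\in\mathcal V$; and $\sum_{i\in\mathcal V}\rho_i=0$.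
   Context: For $(k,\ell)\in\mathcal E$, $a,b\in\{1,\dots,m\}$ and $y\in\{1,\dots,m\}^{n-2}$, $z^{k,\ell}(a,b,y):=(y_1,\dots,y_{k-1},a,y_k,\dots,y_{\ell-2},b,y_{\ell-1},\dots,y_{n-2})$, i.e. the point with $a$ in coordinate $k$, $b$ in coordinate $\ell$, and the entries of $y$ in order in the other coordinates. *)

(* Defs.v *)
From HB Require Import structures.
From mathcomp Require Import all_boot all_order all_algebra.
From mathcomp Require Import reals.

Set Implicit Arguments.
Unset Strict Implicit.
Unset Printing Implicit Defensive.

Import Order.TTheory GRing.Theory Num.Theory.
Local Open Scope ring_scope.

(* The sets {1,...,n} and {1,...,m} are 'I_n and 'I_m (indices shifted by 1), *)
(* and {1,...,m}^n is n.-tuple 'I_m.                                          *)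

Definition edges (n : nat) : {set 'I_n * 'I_n} := 
  [set e : 'I_n * 'I_n | (e.1 < e.2)%N].

(* f is total on pairs of indices, but only its values f i j with (i, j) an   *)
(* edge are ever used.                                                        *)
Definition pair_sum (R : realType) (m n : nat)
    (f : 'I_n -> 'I_n -> 'I_m -> 'I_m -> R) (x : n.-tuple 'I_m) : R :=
  \sum_(e in edges n) f e.1 e.2 (tnth x e.1) (tnth x e.2).

(* With k and l counted from 0, the entries of y placed before a are its      *)
(* first k ones, and those placed before b are its first l - 1 ones.          *)
Definition insert2_seq (T : Type) (k l : nat) (a b : T) (y : seq T) : seq T :=
  take k y ++ a :: drop k (take l.-1 y) ++ b :: drop l.-1 y.

Lemma size_insert2_seq (T : Type) (n k l : nat) (a b : T)
    (y : (n - 2).-tuple T) :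
  (k < l < n)%N -> size (insert2_seq k l a b y) = n.
Proof.
case/andP=> kl ln; have l_gt0 : (0 < l)%N by apply: leq_ltn_trans kl.
have n_gt1 : (1 < n)%N by apply: leq_ltn_trans ln.
have l1n : (l.-1 <= n - 2)%N.
  by rewrite -(leq_add2r 2) subnK // addn2 prednK.
have kl1 : (k <= l.-1)%N by rewrite -ltnS prednK.
rewrite /insert2_seq !(size_cat, size_drop) /= size_cat size_drop /=.
rewrite size_drop !size_takel ?size_tuple // ?(leq_trans kl1) //.
by rewrite !addnS addnA subnKC // subnKC // -addn2 subnK.
Qed.

(* The default value a of nth is irrelevant for k < l, by size_insert2_seq.   *)
Definition insert2 (m n : nat) (k l : 'I_n) (a b : 'I_m)
    (y : (n - 2).-tuple 'I_m) : n.-tuple 'I_m :=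
  [tuple nth a (insert2_seq k l a b y) i | i < n].

Definition marginal_null (R : realType) (m n : nat)
    (F : n.-tuple 'I_m -> R) : Prop :=
  forall (a b : 'I_m) (k l : 'I_n), (k, l) \in edges n ->
    \sum_(y : (n - 2).-tuple 'I_m) F (insert2 k l a b y) = 0.

Definition global_null (R : realType) (m n : nat)
    (F : n.-tuple 'I_m -> R) : Prop :=
  forall x : n.-tuple 'I_m, F x = 0.

(* rho i j is only used for i != j.                                           *)
Definition dual_null (R : realType) (m n : nat)
    (f : 'I_n -> 'I_n -> 'I_m -> 'I_m -> R) : Prop :=
  exists (rho : 'I_n -> 'I_n -> 'I_m -> R) (rho0 : 'I_n -> R),
    [/\ forall (i j : 'I_n) (a b : 'I_m), (i, j) \in edges n ->
          f i j a b = rho i j a + rho j i b,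
        forall (i : 'I_n) (a : 'I_m),
          \sum_(j < n | j != i) rho i j a = rho0 i
      & \sum_(i < n) rho0 i = 0].

(* Main.v *)
Require Import Defs.
From HB Require Import structures.
From mathcomp Require Import all_boot all_order all_algebra.
From mathcomp Require Import reals.
From mathcomp Require Import lra.

Set Implicit Arguments.
Unset Strict Implicit.
Unset Printing Implicit Defensive.

(** Write [F] for [pair_sum f].

    The marginal constraint says that [F] is orthogonal, for the counting
    measure on configurations, to every function of two coordinates.  Since [F]
    is itself a sum of such functions, it is orthogonal to itself, so that
    [\sum_x F x ^+ 2 = 0] and [F] vanishes ([marginal_global]).  The only
    combinatorial input is that inserting two entries into a shorter tuple
    enumerates all tuples ([sum_insert2]).

    If [F] vanishes, the terms of [F x] that involve the coordinate [i] have a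
    sum that does not change when [x i] is changed: with [g] the symmetric extension
    of [f] ([sym_ext]), the sum [\sum_(j | j != i) g i j a (x j)] does not
    depend on [a] ([local_sum_const]).  Comparing this for the configuration
    constantly equal to [o] and for the one that takes the value [b] at [j] and
    [o] elsewhere shows that the mixed differences
    [g i j a b - g i j a o - g i j o b + g i j o o] vanish, which splits [f]
    along [rho i j a := g i j a o - g i j o o / 2] ([global_dual]).

    Conversely, when [f] splits along [rho], regrouping the terms of [F x] by
    vertex instead of by edge gives [\sum_i rho0 i = 0] ([dual_global]). *)

Import Order.TTheory GRing.Theory Num.Theory.
Local Open Scope ring_scope.

(** * Inserting two entries into a tuple *)

Section Insertion.

Variables (m n : nat) (k l : 'I_n).
Hypothesis kl : (k, l) \in edges n.

Let kln : (k < l < n)%N.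
Proof. by move: kl; rewrite inE /= => ->; rewrite ltn_ord. Qed.

Let le_k_pred_l : (k <= l.-1)%N.
Proof. by case/andP: kln => kl' _; rewrite -ltnS prednK // (leq_trans _ kl'). Qed.

Let le_pred_l : (l.-1 <= n - 2)%N.
Proof.
case/andP: kln => kl' ln; have l_gt0 : (0 < l)%N by apply: leq_ltn_trans kl'.
by rewrite leq_subRL ?add2n ?prednK // (leq_ltn_trans l_gt0 ln).
Qed.

Lemma tval_insert2 (a b : 'I_m) (y : (n - 2).-tuple 'I_m) :
  insert2 k l a b y = insert2_seq k l a b y :> seq 'I_m.
Proof.
apply: (@eq_from_nth _ a); first by rewrite size_tuple size_insert2_seq.
move=> i; rewrite size_tuple => lt_in.
by rewrite -(tnth_nth a _ (Ordinal lt_in)) tnth_mktuple.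
Qed.

Lemma tnth_insert2l (a b : 'I_m) (y : (n - 2).-tuple 'I_m) :
  tnth (insert2 k l a b y) k = a.
Proof.
rewrite tnth_mktuple /insert2_seq nth_cat size_takel ?ltnn ?subnn //.
by rewrite size_tuple (leq_trans le_k_pred_l).
Qed.

Lemma tnth_insert2r (a b : 'I_m) (y : (n - 2).-tuple 'I_m) :
  tnth (insert2 k l a b y) l = b.
Proof.
case/andP: kln => kl' ln; have l_gt0 : (0 < l)%N by apply: leq_ltn_trans kl'.
rewrite tnth_mktuple /insert2_seq nth_cat size_takel; last first.
  by rewrite size_tuple (leq_trans le_k_pred_l).
rewrite ltnNge (ltnW kl') /= -(prednK l_gt0) subSn //= nth_cat.
by rewrite size_drop size_takel ?size_tuple // ltnn subnn.
Qed.

Lemma insert2_inj :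
  injective (fun u : ('I_m * 'I_m) * (n - 2).-tuple 'I_m =>
               insert2 k l u.1.1 u.1.2 u.2).
Proof.
move=> [[a b] y] [[a' b'] y'] /= eq_ins.
have eq_a : a = a' by rewrite -(tnth_insert2l a b y) eq_ins tnth_insert2l.
have eq_b : b = b' by rewrite -(tnth_insert2r a b y) eq_ins tnth_insert2r.
have := congr1 (@tval _ _) eq_ins; rewrite !tval_insert2 /insert2_seq.
have le_k (z : (n - 2).-tuple 'I_m) : (k <= size z)%N.
  by rewrite size_tuple (leq_trans le_k_pred_l).
have le_l (z : (n - 2).-tuple 'I_m) : (l.-1 <= size z)%N by rewrite size_tuple.
move/eqP; rewrite eqseq_cat ?size_takel //= eqseq_cons => /and3P[/eqP eq1 _].
rewrite eqseq_cat ?size_drop ?size_takel // eqseq_cons.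
case/and3P=> /eqP eq2 _ /eqP eq3.
rewrite eq_a eq_b; congr pair; apply: val_inj => /=.
rewrite -(cat_take_drop l.-1 y) -(cat_take_drop l.-1 y') eq3; congr cat.
rewrite -(cat_take_drop k (take l.-1 y)) -(cat_take_drop k (take l.-1 y')) eq2.
by rewrite !take_takel ?eq1.
Qed.

(** By injectivity and equality of cardinals, each tuple is obtained exactly
    once by inserting two entries into a shorter tuple. *)
Lemma sum_insert2 (V : nmodType) (G : n.-tuple 'I_m -> V) :
  \sum_x G x = \sum_a \sum_b \sum_y G (insert2 k l a b y).
Proof.
rewrite (reindex (fun u : ('I_m * 'I_m) * (n - 2).-tuple 'I_m =>
                    insert2 k l u.1.1 u.1.2 u.2)) /=; last first.
  apply: onW_bij; apply: inj_card_bij insert2_inj _.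
  rewrite !card_prod !card_tuple !card_ord mulnn -expnD subnKC //.
  by case/andP: kln => kl' ln; rewrite (leq_trans _ ln) // ltnS (leq_ltn_trans _ kl').
by rewrite [RHS]pair_bigA /= [RHS]pair_bigA.
Qed.

End Insertion.

(** * Sums over ordered pairs and over edges *)

Lemma sum_offdiag_edges (V : nmodType) (n : nat) (h : 'I_n -> 'I_n -> V) :
  \sum_i \sum_(j | j != i) h i j =
  \sum_(e in edges n) (h e.1 e.2 + h e.2 e.1).
Proof.
rewrite pair_big_dep /= (bigID (mem (edges n))) /= big_split /=; congr (_ + _).
  apply: eq_bigl => -[i j]; rewrite inE /= andb_idl // => lt_ij.
  by rewrite neq_ltn lt_ij orbT.
rewrite (reindex_inj (can_inj (@swap_pairK 'I_n 'I_n))) /=.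
apply: eq_bigl => -[i j]; rewrite !inE /= -leqNgt ltn_neqAle.
by rewrite -val_eqE.
Qed.

(** The family indexed by all ordered pairs of distinct vertices, symmetric
    under the exchange of both the vertices and the arguments, that agrees
    with [f] on edges. *)
Definition sym_ext (V : Type) (m n : nat) (f : 'I_n -> 'I_n -> 'I_m -> 'I_m -> V)
    (i j : 'I_n) (a b : 'I_m) : V :=
  if (i < j)%N then f i j a b else f j i b a.

Lemma sym_extC (V : Type) (m n : nat) (f : 'I_n -> 'I_n -> 'I_m -> 'I_m -> V)
    (i j : 'I_n) (a b : 'I_m) :
  i != j -> sym_ext f i j a b = sym_ext f j i b a.
Proof. by rewrite /sym_ext -val_eqE /=; case: ltngtP. Qed.

Lemma sum_sym_ext (R : realType) (m n : nat)
    (f : 'I_n -> 'I_n -> 'I_m -> 'I_m -> R) (x : n.-tuple 'I_m) :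
  \sum_i \sum_(j | j != i) sym_ext f i j (tnth x i) (tnth x j) =
  pair_sum f x *+ 2.
Proof.
rewrite sum_offdiag_edges -sumrMnl; apply: eq_bigr => -[i j].
by rewrite inE /sym_ext /= => lt_ij; rewrite lt_ij ltnNge (ltnW lt_ij) mulr2n.
Qed.

(** * The marginal constraint implies the global one *)

Section Equivalences.

Variables (R : realType) (m n : nat) (f : 'I_n -> 'I_n -> 'I_m -> 'I_m -> R).

Lemma marginal_global : marginal_null (pair_sum f) -> global_null (pair_sum f).
Proof.
move=> Fmarg.
have orth e : e \in edges n ->
    \sum_x pair_sum f x * f e.1 e.2 (tnth x e.1) (tnth x e.2) = 0.
  case: e => k l kl /=; rewrite (sum_insert2 kl) big1 // => a _.
  rewrite big1 // => b _.
  under eq_bigr do rewrite tnth_insert2l // tnth_insert2r //.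
  by rewrite -mulr_suml Fmarg // mul0r.
have sqr_sum0 : \sum_x pair_sum f x * pair_sum f x = 0.
  under eq_bigr do rewrite {2}/pair_sum mulr_sumr.
  by rewrite exchange_big /= big1.
move=> x; apply/eqP; rewrite -[_ == 0]orbb -mulf_eq0; apply/eqP.
by apply: (psumr_eq0P _ sqr_sum0) => // z _; rewrite -expr2 sqr_ge0.
Qed.

(** * The global and the dual constraints *)

(** Twice the pair sum of [x] is twice the right-hand side, which collects the
    terms that involve [x i], plus terms that do not involve [x i].  The latter
    are unaffected when [x i] is replaced by [a]. *)
Lemma local_sum_const (x : n.-tuple 'I_m) (i : 'I_n) (a : 'I_m) :
  global_null (pair_sum f) ->
  \sum_(j | j != i) sym_ext f i j a (tnth x j) =
  \sum_(j | j != i) sym_ext f i j (tnth x i) (tnth x j).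
Proof.
move=> F0.
have split (z : n.-tuple 'I_m) :
    (\sum_(j | j != i) sym_ext f i j (tnth z i) (tnth z j)) *+ 2 +
    \sum_(k | k != i) \sum_(j | (j != k) && (j != i))
       sym_ext f k j (tnth z k) (tnth z j) = 0.
  transitivity (pair_sum f z *+ 2); last by rewrite F0 mul0rn.
  rewrite -sum_sym_ext [in RHS](bigD1 i) //=.
  rewrite mulr2n -addrA.
  congr (_ + _); rewrite -big_split /=; apply: eq_bigr => k ki.
  by rewrite [in RHS](bigD1 i) 1?eq_sym //= sym_extC // eq_sym.
pose x' : n.-tuple 'I_m := [tuple if j == i then a else tnth x j | j < n].
have x'i : tnth x' i = a by rewrite tnth_mktuple eqxx.
have x'j j : j != i -> tnth x' j = tnth x j.
  by rewrite tnth_mktuple => /negbTE ->.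
have := split x'; rewrite x'i.
under eq_bigr => j ji do rewrite x'j //.
under [X in _ + X]eq_bigr => k ki do
  (under eq_bigr => j /andP[_ ji] do rewrite !x'j //).
by have := split x; rewrite !mulr2n; lra.
Qed.

(** The splitting is normalised at a base value [o].  Halving the constant
    [g i j o o] between the two endpoints of an edge keeps the formula for
    [rho i j] uniform in the order of [i] and [j]. *)
Lemma global_dual_base (o : 'I_m) : global_null (pair_sum f) -> dual_null f.
Proof.
move=> F0; pose g := sym_ext f; pose xo : n.-tuple 'I_m := [tuple o | _ < n].
have xoE i : tnth xo i = o by rewrite tnth_mktuple.
have base_const i a : \sum_(j | j != i) g i j a o = \sum_(j | j != i) g i j o o.
  have := local_sum_const xo i a F0; rewrite xoE.
  under eq_bigr do rewrite xoE.
  by under [in RHS]eq_bigr do rewrite xoE.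
have mixed i j a b : j != i -> g i j a b - g i j a o = g i j o b - g i j o o.
  move=> ji; pose xb : n.-tuple 'I_m := [tuple if k == j then b else o | k < n].
  have xbE k : tnth xb k = if k == j then b else o by rewrite tnth_mktuple.
  have split c : \sum_(k | k != i) g i k c (tnth xb k) =
      g i j c b - g i j c o + \sum_(k | k != i) g i k c o.
    rewrite (bigD1 j) //= [in RHS](bigD1 j) //= xbE eqxx addrA subrK.
    by congr (_ + _); apply: eq_bigr => k /andP[_ /negbTE kj]; rewrite xbE kj.
  have := local_sum_const xb i a F0.
  rewrite [tnth xb i]xbE eq_sym (negbTE ji) !split (base_const i a).
  exact: addIr.
exists (fun i j a => g i j a o - g i j o o / 2).
exists (fun i => \sum_(j | j != i) (g i j o o - g i j o o / 2)); split.
- move=> i j a b; rewrite inE /= => lt_ij.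
  have ij : j != i by rewrite -val_eqE /= neq_ltn lt_ij orbT.
  have gC c d : g j i c d = g i j d c by rewrite /g sym_extC.
  have -> : f i j a b = g i j a b by rewrite /g /sym_ext lt_ij.
  by have := mixed i j a b ij; rewrite !gC; lra.
- by move=> i a; rewrite !sumrB base_const.
- have half (c : R) : c - c / 2 = c / 2 by lra.
  under eq_bigr do under eq_bigr do rewrite half.
  under eq_bigr do rewrite -mulr_suml.
  rewrite -mulr_suml; have := sum_sym_ext f xo.
  under eq_bigr do under eq_bigr do rewrite !xoE.
  by rewrite F0 mul0rn => ->; rewrite mul0r.
Qed.

Lemma global_dual : global_null (pair_sum f) -> dual_null f.
Proof.
case: (pickP 'I_m) => [o _ | m_empty]; first exact: global_dual_base.
(* When m = 0 there is no base value, but the first two conditions are vacuous. *)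
move=> _; exists (fun _ _ _ => 0), (fun=> 0); split.
- by move=> i j a; have := m_empty a.
- by move=> i a; have := m_empty a.
- by rewrite big1.
Qed.

Lemma dual_global : dual_null f -> global_null (pair_sum f).
Proof.
case=> rho [rho0 [f_rho rho_sum rho0_sum]] x.
rewrite -[RHS]rho0_sum /pair_sum.
under [RHS]eq_bigr => i _ do rewrite -(rho_sum i (tnth x i)).
rewrite sum_offdiag_edges; apply: eq_bigr => -[i j] ij /=; exact: f_rho.
Qed.

End Equivalences.

Theorem mainTheorem2 (R : realType) (m n : nat) (n_ge2 : (2 <= n)%N)
    (f : 'I_n -> 'I_n -> 'I_m -> 'I_m -> R) :
  (marginal_null (pair_sum f) <-> global_null (pair_sum f)) /\
  (global_null (pair_sum f) <-> dual_null f).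
Proof.
split; split; [exact: marginal_global | | exact: global_dual
              | exact: dual_global].
by move=> F0 a b k l _; rewrite big1.
Qed.
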